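(* Let $\mathcal{H}$ be a complex Hilbert space, let $T \in B(\mathcal{H})$, and let $N(\cdot)$ be a self-adjoint norm on $B(\mathcal{H})$. Then $$dw_N(T) \geq \frac12 \sqrt{\frac32 w_N^2(T) + 2N^4(|T|) + (d_1 + d_2) + 2|m_1 - m_2|},$$ where $$m_1 = \max\{N^2(\Re(T)) + N^4(|T|),\ w_N^2(T)\}, \qquad m_2 = \max\{N^2(\Im(T)),\ N^4(|T|)\},$$ $$d_1 = |N^2(\Re(T)) + N^4(|T|) - w_N^2(T)|, \qquad d_2 = |N^2(\Im(T)) - N^4(|T|)|.$$
   Context: $B(\mathcal{H})$ is the $C^*$-algebra of bounded linear operators on the complex Hilbert space $\mathcal{H}$. For $T \in B(\mathcal{H})$, $T^*$ is the adjoint, $|T| = (T^*T)^{1/2}$, $\Re(T) = \frac12(T + T^* )$ and $\Im(T) = \frac{1}{2i}(T - T^* )$. A norm $N(\cdot)$ on $B(\mathcal{H})$ (as a complex vector space) is self-adjoint if $N(T) = N(T^* )$ for every $T \in B(\mathcal{H})$. $N^k(X)$ means $(N(X))^k$ and $w_N^2(T)$ means $(w_N(T))^2$. The generalized numerical radius is $w_N(T) = \sup_{\theta \in \mathbb{R}} N(\Re(e^{i\theta}T))$. The generalized Davis--Wielandt radius is $dw_N(T) = \sup_{\theta \in \mathbb{R}} \sqrt{N^2(\Re(e^{i\theta}T)) + N^4(\Re(e^{i\theta}|T|))}$. *)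

(* Defs.v *)
From HB Require Import structures.
From mathcomp Require Import all_boot all_order all_algebra complex.
From mathcomp Require Import all_classical all_reals all_analysis.

Set Implicit Arguments.
Unset Strict Implicit.
Unset Printing Implicit Defensive.

Import Order.TTheory GRing.Theory Num.Theory.
Import numFieldNormedType.Exports.

Local Open Scope ring_scope.
Local Open Scope complex_scope.
Local Open Scope classical_set_scope.

(* [inner] is linear in its first argument, conjugate-linear in the second *)
HB.mixin Record NormedModule_isHilbert (R : realType) H
    & CompleteNormedModule R[i] H := {
  inner : {dot H for (@Num.conj R[i])};
  inner_norm : forall x : H, inner x x = `|x| ^+ 2
}.

#[short(type="hilbertType")]
HB.structure Definition Hilbert (R : realType) :=
  {H of CompleteNormedModule R[i] H & NormedModule_isHilbert R H}.

Section bounded_operators.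
Context {R : realType}.
Implicit Type H : hilbertType R.

Definition bounded_operator H : {pred (H -> H)} :=
  mem [set f : H -> H | linear f /\ exists M : R[i], forall x, `|f x| <= M * `|x|].

Record bop H := Bop {
  bop_fun :> H -> H ;
  bop_subproof : bop_fun \in @bounded_operator H
}.

HB.instance Definition _ H := [isSub for @bop_fun H].
HB.instance Definition _ H := [Choice of bop H by <:].

Lemma bounded_operatorP H (f : H -> H) :
  reflect (linear f /\ exists M : R[i], forall x, `|f x| <= M * `|x|)
    (f \in @bounded_operator H).
Proof. by apply: (iffP idP); rewrite inE. Qed.

Fact bounded_operator_submod H : submod_closed (@bounded_operator H).
Proof.
split=> [|a f g].
  apply/bounded_operatorP; split=> [b x y|].
    by rewrite /= scaler0 addr0.
  by exists 0 => x; rewrite normr0 mul0r.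
move=> /bounded_operatorP[lf [M fM]] /bounded_operatorP[lg [K gK]].
apply/bounded_operatorP; split=> [b x y|].
  rewrite /= !fctE lf lg !scalerDr !scalerA (mulrC b a) -!addrA.
  by congr (_ + _); rewrite addrCA.
exists (`|a| * M + K) => x; rewrite mulrDl -mulrA.
apply: (le_trans (ler_normD _ _)); apply: lerD => //.
by rewrite normrZ; apply: ler_wpM2l.
Qed.

HB.instance Definition _ H :=
  GRing.isSubmodClosed.Build R[i] (H -> H) (@bounded_operator H)
    (bounded_operator_submod H).
HB.instance Definition _ H := [SubChoice_isSubLmodule of bop H by <:].

End bounded_operators.

Notation "''B' ( H )" := (bop H) (at level 8, format "''B' ( H )") : type_scope.

Section operators.
Context {R : realType} {H : hilbertType R}.
Implicit Types (S T A : 'B(H)) (t : R).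

(* [T^*] and [|T|] exist and are unique on a Hilbert space; [xget] selects them,
   its default value [0] being irrelevant. *)
Definition is_adjoint T S : Prop :=
  forall x y : H, inner (T x) y = inner x (S y).

Definition adjoint T : 'B(H) := xget 0 [set S | is_adjoint T S].

Definition positive_operator A : Prop := forall x : H, 0 <= inner (A x) x.

Definition opabs T : 'B(H) :=
  xget 0 [set A | positive_operator A /\ forall x, A (A x) = adjoint T (T x)].

Definition opRe T : 'B(H) := 2^-1 *: (T + adjoint T).

Definition opIm T : 'B(H) := (2 * 'i)^-1 *: (T - adjoint T).

Definition expi t : R[i] := cos t +i* sin t.

Definition is_opnorm (N : 'B(H) -> R) : Prop :=
  [/\ forall T, 0 <= N T,
      forall T, N T = 0 -> T = 0,
      forall (c : R[i]) T, (N (c *: T))%:C = `|c| * (N T)%:C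
    & forall S T, N (S + T) <= N S + N T].

Definition selfadjoint_norm (N : 'B(H) -> R) : Prop :=
  forall T, N T = N (adjoint T).

(* For a norm [N] both suprema are over nonempty bounded sets, so the real [sup]
   is the genuine one. *)
Definition wN (N : 'B(H) -> R) T : R :=
  sup (range (fun t : R => N (opRe (expi t *: T)))).

Definition dwN (N : 'B(H) -> R) T : R :=
  sup (range (fun t : R =>
    Num.sqrt (N (opRe (expi t *: T)) ^+ 2 + N (opRe (expi t *: opabs T)) ^+ 4))).

End operators.

(* Main.v *)
Require Import Defs.
From mathcomp Require Import all_boot all_order all_algebra complex.
From mathcomp Require Import all_classical all_reals all_analysis.
From mathcomp Require Import ring lra.

Import Order.TTheory GRing.Theory Num.Theory.
Import numFieldNormedType.Exports.
Local Open Scope ring_scope.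

(** Write [a = N (Re T)], [b = N (Im T)], [p = N |T|], [w = w_N(T)].

    The identity [Re (e^(it) T) = cos t Re T - sin t Im T] governs everything:
    for self-adjoint [A] it reads [Re (e^(it) A) = cos t A], so that the [t]-term
    in the supremum defining [dw_N(T)] is
    [sqrt (N (Re (e^(it) T))^2 + cos t ^4 p^4)].
    - At [t = 0] that term gives [dw^2 >= a^2 + p^4], at [t = pi/2] it gives
      [dw^2 >= b^2], and dropping its second summand for every [t] gives
      [dw >= w]. Hence [dw^2 >= max m1 m2].
    - The triangle inequality and Cauchy-Schwarz bound
      [N (Re (e^(it) T))] by [|cos t| a + |sin t| b <= sqrt (a^2 + b^2)], hence
      [w^2 <= a^2 + b^2]. The same bound shows that both suprema are finite.

    Replacing each maximum by half of (sum + distance) turns [4 max m1 m2] into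
    [a^2 + b^2 + w^2 + 2 p^4 + d1 + d2 + 2 |m1 - m2|], and
    [a^2 + b^2 >= w^2 / 2] finishes the proof.

    Adjoints and absolute values being selected by choice with default [0], two
    facts hold without existence results: [(c T)^* = c^* T^*], because for
    [c <> 0] the map [S |-> c^* S] is a bijection between the adjoints of [T] and
    those of [c T] ([adjointZ]), and the self-adjointness of [|T|], which follows
    from positivity alone ([positive_selfadjoint]). *)

Section adjoints.
Context {R : realType} {H : hilbertType R}.
Implicit Types (S T A : 'B(H)) (c : R[i]).

Lemma innerDl (x y z : H) : inner (x + y) z = inner x z + inner y z.
Proof. exact: linearDl. Qed.

Lemma innerDr (x y z : H) : inner z (x + y) = inner z x + inner z y.
Proof. exact: linearDr. Qed.

Lemma innerZl c (x y : H) : inner (c *: x) y = c * inner x y.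
Proof. exact: linearZl_LR. Qed.

Lemma innerZr c (x y : H) : inner x (c *: y) = Num.conj c * inner x y.
Proof. exact: linearZr_LR. Qed.

Lemma inner_conj (x y : H) : inner x y = Num.conj (inner y x).
Proof. by rewrite (hermC inner) expr0 mul1r. Qed.

Lemma inner_inj (u v : H) : (forall x, inner x u = inner x v) -> u = v.
Proof.
move=> uv; apply/eqP; rewrite -subr_eq0 -(dnorm_eq0 inner).
by rewrite -[in X in inner _ X](scaleN1r v) innerDr innerZr rmorphN1 mulN1r uv subrr.
Qed.

Lemma bop_linear T c (x y : H) : T (c *: x + y) = c *: T x + T y.
Proof. by have /bounded_operatorP[linT _] := bop_subproof T; exact: linT. Qed.

Lemma adjoint_unique T S : is_adjoint T S -> adjoint T = S.
Proof.
move=> TS; apply: xget_unique => // S' TS'; apply/val_inj/funext => y.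
by apply: inner_inj => x; rewrite -TS' -TS.
Qed.

Lemma is_adjointZ c T S :
  is_adjoint T S -> is_adjoint (c *: T) (Num.conj c *: S).
Proof. by move=> TS x y; rewrite /= innerZl innerZr conjCK TS. Qed.

(** If [T] has no adjoint and [c != 0], then [c *: T] has none either, and both
    sides are the default [0]. *)
Lemma adjointZ c T : adjoint (c *: T) = Num.conj c *: adjoint T.
Proof.
have [->|c0] := eqVneq c 0.
  rewrite conjC0 !scale0r; apply: adjoint_unique => x y /=.
  by rewrite (linear0l inner) (linear0r inner).
have [[S TS]|noS] := pselect (exists S, is_adjoint T S).
  by rewrite (adjoint_unique _ _ TS); exact/adjoint_unique/is_adjointZ.
have adj0 T' : (forall S, ~ is_adjoint T' S) -> adjoint T' = 0.
  by move=> h; apply: xgetPN.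
rewrite !adj0 ?scaler0 // => S TS; apply: noS; first by exists S.
exists (Num.conj c^-1 *: S).
by rewrite -[T](scalerK c0); exact: is_adjointZ.
Qed.

(** Polarization: [<Az, z>] is real for [z = x + y] and [z = ix + y], so with
    [u = <Ax, y>] and [v = <Ay, x>] both [u + v] and [i (u - v)] are real,
    whence [v] is the conjugate of [u]. *)
Lemma positive_selfadjoint A : positive_operator A -> adjoint A = A.
Proof.
move=> A0; apply: adjoint_unique => x y; rewrite [RHS]inner_conj.
have real_diag z : Num.conj (inner (A z) z) = inner (A z) z.
  exact: (geC0_conj (A0 z)).
(* The off-diagonal part of the real number <A z, z> at z = c x + y. *)
have cross c : Num.conj (c * inner (A x) y + Num.conj c * inner (A y) x)
             = c * inner (A x) y + Num.conj c * inner (A y) x.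
  have := real_diag (c *: x + y).
  rewrite bop_linear !(innerDl, innerDr, innerZl, innerZr).
  rewrite !(rmorphD, rmorphM) /= !conjCK !real_diag => e.
  by apply: subr0_eq; move/eqP: e; rewrite -subr_eq0 => /eqP <-; ring.
have := cross 1; have := cross 'i.
rewrite !(rmorphD, rmorphM, rmorph1) /= !conjCK !conjCi !mul1r.
move: (inner (A x) y) (inner (A y) x) => u v e1 e2.
have : 2 * 'i * (u - Num.conj v) = 0.
  move/eqP: e1; rewrite -subr_eq0 => /eqP e1; rewrite -[RHS]oppr0 -e1.
  transitivity ('i * (u + v) + 'i * (u - v) - 2 * 'i * Num.conj v); first by ring.
  by rewrite -e2; ring.
by move/eqP; rewrite !mulf_eq0 pnatr_eq0 (negPf (neq0Ci _)) subr_eq0 => /eqP.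
Qed.

(** When no positive square root is available, the default [0] is positive. *)
Lemma positive_opabs T : positive_operator (opabs T).
Proof.
rewrite /opabs; case: xgetP => [A _ []//|_ x /=].
by rewrite (linear0l inner).
Qed.

Lemma expiE (t : R) : expi t = (cos t)%:C%C + 'i * (sin t)%:C%C.
Proof. by rewrite -complexiE /expi [LHS]complexE. Qed.

(** This is [Re ((c + is) (A + iB)) = c A - s B] for the Cartesian decomposition
    [T = A + iB]; the sign sits in the scalar to keep it in the form [r%:C *: S],
    whose norm [opnormZ] computes. *)
Lemma opRe_rot (t : R) T :
  opRe (expi t *: T) = (cos t)%:C%C *: opRe T + (- sin t)%:C%C *: opIm T.
Proof.
rewrite /opRe /opIm adjointZ !scalerA !scalerDr scalerN !scalerA.
rewrite addrACA -!scalerDl -scalerBl expiE invfM invCi.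
have conjR (r : R) : Num.conj r%:C%C = r%:C%C by exact: conjc_real.
rewrite !(rmorphD, rmorphM, rmorphN) /= conjCi !conjR.
by congr (_ *: _ + _ *: _); ring.
Qed.

Lemma opRe_rot_selfadjoint (t : R) A :
  adjoint A = A -> opRe (expi t *: A) = (cos t)%:C%C *: A.
Proof.
move=> A_sa; rewrite opRe_rot /opRe /opIm A_sa subrr !scaler0 addr0.
by rewrite -mulr2n -(scaler_nat 2 A) !scalerA divfK ?pnatr_eq0.
Qed.

End adjoints.

Section radii.
Context {R : realType} {H : hilbertType R} (N : 'B(H) -> R) (hN : is_opnorm N).
Implicit Types (T A : 'B(H)).

Lemma opnorm_ge0 T : 0 <= N T.
Proof. by case: hN. Qed.

Lemma opnormD S T : N (S + T) <= N S + N T.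
Proof. by case: hN. Qed.

Lemma opnormZ (r : R) T : N (r%:C%C *: T) = `|r| * N T.
Proof.
case: hN => _ _ NZ _; apply: complexI; rewrite NZ rmorphM /=; congr (_ * _).
by rewrite normc_def /= expr0n addr0 sqrtr_sqr.
Qed.

Lemma opnorm_opRe_rot_abs (t : R) T :
  N (opRe (expi t *: opabs T)) = `|cos t| * N (opabs T).
Proof.
rewrite opRe_rot_selfadjoint ?opnormZ//.
exact/positive_selfadjoint/positive_opabs.
Qed.

(** Cauchy-Schwarz for the unit vector [(cos t, sin t)]. *)
Lemma opnorm_opRe_rot_sqr_le (t : R) T :
  N (opRe (expi t *: T)) ^+ 2 <= N (opRe T) ^+ 2 + N (opIm T) ^+ 2.
Proof.
set a := N (opRe T); set b := N (opIm T).
apply: (@le_trans _ _ ((`|cos t| * a + `|sin t| * b) ^+ 2)).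
  rewrite lerXn2r ?nnegrE ?opnorm_ge0 ?addr_ge0 ?mulr_ge0 ?opnorm_ge0 //.
  by rewrite opRe_rot (le_trans (opnormD _ _)) // !opnormZ normrN.
have := cos2Dsin2 t; rewrite -[cos t ^+ 2]real_normK ?num_real //.
rewrite -[sin t ^+ 2]real_normK ?num_real //.
move: `|cos t| `|sin t| => c s cs.
(* Lagrange's identity. *)
have -> : a ^+ 2 + b ^+ 2 = (c * a + s * b) ^+ 2 + (s * a - c * b) ^+ 2.
  by rewrite -[LHS]mul1r -cs; ring.
by rewrite lerDl sqr_ge0.
Qed.

(** The supremum [wN] is finite by [opnorm_opRe_rot_sqr_le], hence an upper
    bound. *)
Lemma opnorm_opRe_rot_le_wN (t : R) T : N (opRe (expi t *: T)) <= wN N T.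
Proof.
apply: ub_le_sup; last by exists t.
exists (Num.sqrt (N (opRe T) ^+ 2 + N (opIm T) ^+ 2)) => _ [u _ <-].
rewrite -(ger0_norm (opnorm_ge0 _)) -sqrtr_sqr ler_wsqrtr //.
exact: opnorm_opRe_rot_sqr_le.
Qed.

Lemma wN_ge0 T : 0 <= wN N T.
Proof. exact: le_trans (opnorm_ge0 _) (opnorm_opRe_rot_le_wN 0 T). Qed.

Lemma wN_sqr_le T : wN N T ^+ 2 <= N (opRe T) ^+ 2 + N (opIm T) ^+ 2.
Proof.
rewrite -[leRHS]sqr_sqrtr ?addr_ge0 ?sqr_ge0 //.
rewrite lerXn2r ?nnegrE ?wN_ge0 ?sqrtr_ge0 //.
apply: ge_sup; first by exists (N (opRe (expi 0 *: T))), 0.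
move=> _ [t _ <-]; rewrite -(ger0_norm (opnorm_ge0 _)) -sqrtr_sqr ler_wsqrtr //.
exact: opnorm_opRe_rot_sqr_le.
Qed.

(** The first summand is bounded as for [wN], the second by [|cos t| <= 1]. *)
Lemma dwN_term_le (t : R) T :
  Num.sqrt (N (opRe (expi t *: T)) ^+ 2 + N (opRe (expi t *: opabs T)) ^+ 4)
    <= dwN N T.
Proof.
apply: ub_le_sup; last by exists t.
exists (Num.sqrt (N (opRe T) ^+ 2 + N (opIm T) ^+ 2 + N (opabs T) ^+ 4)).
move=> _ [u _ <-]; rewrite ler_wsqrtr // lerD ?opnorm_opRe_rot_sqr_le //.
rewrite opnorm_opRe_rot_abs lerXn2r ?nnegrE ?mulr_ge0 ?opnorm_ge0 //.
by rewrite ler_piMl ?opnorm_ge0 // ler_norml cos_geN1 cos_le1.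
Qed.

Lemma dwN_ge0 T : 0 <= dwN N T.
Proof. exact: le_trans (sqrtr_ge0 _) (dwN_term_le 0 T). Qed.

Lemma dwN_sqr_ge (t : R) T :
  N (opRe (expi t *: T)) ^+ 2 + (`|cos t| * N (opabs T)) ^+ 4 <= dwN N T ^+ 2.
Proof.
rewrite -opnorm_opRe_rot_abs -[leLHS]sqr_sqrtr; last first.
  by rewrite addr_ge0 ?exprn_ge0 ?opnorm_ge0.
by rewrite lerXn2r ?nnegrE ?sqrtr_ge0 ?dwN_ge0 ?dwN_term_le.
Qed.

(** The angle [0]. *)
Lemma dwN_sqr_ge_opRe T : N (opRe T) ^+ 2 + N (opabs T) ^+ 4 <= dwN N T ^+ 2.
Proof.
have := dwN_sqr_ge 0 T.
by rewrite opRe_rot cos0 sin0 oppr0 scale0r addr0 scale1r normr1 mul1r.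
Qed.

(** The angle [pi / 2], where [Re (i T) = - Im T] and [Re (i |T|) = 0]. *)
Lemma dwN_sqr_ge_opIm T : N (opIm T) ^+ 2 <= dwN N T ^+ 2.
Proof.
have := dwN_sqr_ge (pi / 2) T.
rewrite opRe_rot cos_pihalf sin_pihalf scale0r add0r opnormZ normrN normr1 mul1r.
by rewrite normr0 mul0r expr0n addr0.
Qed.

Lemma wN_le_dwN T : wN N T <= dwN N T.
Proof.
apply: ge_sup; first by exists (N (opRe (expi 0 *: T))), 0.
move=> _ [t _ <-]; apply: le_trans (dwN_term_le t T).
rewrite -{1}(ger0_norm (opnorm_ge0 _)) -sqrtr_sqr ler_wsqrtr // lerDl.
by rewrite exprn_ge0 ?opnorm_ge0.
Qed.

End radii.

Theorem theorem7 (R : realType) (H : hilbertType R) (N : 'B(H) -> R)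
    (hN : is_opnorm N) (hsa : selfadjoint_norm N) (T : 'B(H)) :
  let m1 := Num.max (N (opRe T) ^+ 2 + N (opabs T) ^+ 4) (wN N T ^+ 2) in
  let m2 := Num.max (N (opIm T) ^+ 2) (N (opabs T) ^+ 4) in
  let d1 := `|N (opRe T) ^+ 2 + N (opabs T) ^+ 4 - wN N T ^+ 2| in
  let d2 := `|N (opIm T) ^+ 2 - N (opabs T) ^+ 4| in
  2^-1 * Num.sqrt (3 / 2 * wN N T ^+ 2 + 2 * N (opabs T) ^+ 4 + (d1 + d2)
                   + 2 * `|m1 - m2|)
    <= dwN N T.
Proof.
have hRe := dwN_sqr_ge_opRe N hN T; have hIm := dwN_sqr_ge_opIm N hN T.
have hw : wN N T ^+ 2 <= dwN N T ^+ 2.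
  by rewrite lerXn2r ?nnegrE ?wN_ge0 ?dwN_ge0 ?wN_le_dwN.
have hab := wN_sqr_le N hN T; have dw0 := dwN_ge0 N hN T.
have a0 := sqr_ge0 (N (opRe T)); have w0 := sqr_ge0 (wN N T).
cbv zeta; rewrite -ler_pdivlMl ?invr_gt0 // invrK.
rewrite -[leRHS]ger0_norm ?mulr_ge0 // -[leRHS]sqrtr_sqr ler_wsqrtr // exprMn.
move: (N (opRe T) ^+ 2) (N (opIm T) ^+ 2) (N (opabs T) ^+ 4) (wN N T ^+ 2)
  (dwN N T ^+ 2) hRe hIm hw hab a0 w0 => a2 b2 p4 w2 dw2 hRe hIm hw hab a0 w0.
have maxE (x y : R) : 2 * Num.max x y = x + y + `|x - y|.
  by rewrite maxr_absE; lra.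
have hm1 : Num.max (a2 + p4) w2 <= dw2 by rewrite ge_max hRe.
(* p^4 <= dw^2 because a^2 + p^4 <= dw^2. *)
have hm2 : Num.max b2 p4 <= dw2 by rewrite ge_max hIm; lra.
have := maxE (a2 + p4) w2; have := maxE b2 p4.
move: hm1 hm2.
move: (Num.max (a2 + p4) w2) (Num.max b2 p4) => m1 m2 hm1 hm2.
(* Once the three maxima are expanded, only a^2 + b^2 >= w^2 / 2 is left. *)
have hm : Num.max m1 m2 <= dw2 by rewrite ge_max hm1.
have := maxE m1 m2; lra.
Qed.
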